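(* Let $X$ and $Y$ be metric spaces and let $f:X\to Y$ be a map. Then $f$ is not $LC_2$-measurable if and only if there exists a point $x\in X$ such that $f$ is not $LC_2$-measurable at $x$.
   Context: A subset of $X$ is an $LC_1$ set if it is the intersection of an open and a closed subset of $X$; it is an $LC_2$ set if it is the union of two $LC_1$ sets. The map $f$ (not assumed continuous) is not $LC_2$-measurable if there is an open set $U\subseteq Y$ such that $f^{-1}(U)$ is not an $LC_2$ set in $X$. Let $D_0=\{0\}\subset\mathbb{R}$ and, for $k\ge 1$, let $D_k=\{2^{-n_1}+\dots+2^{-n_k} : n_1<n_2<\dots<n_k,\ n_i\in\mathbb{N}^+\}$. Let $S_4=D_0\cup D_1\cup D_2\cup D_3\cup D_4$, a compact subspace of $\mathbb{R}$. For $x\in X$, a set $S_4(x)\subseteq X$ is the image of $S_4$ under some homeomorphism $h$ of $S_4$ onto a subspace of $X$ with $h(0)=x$; write $D_j(x)=h(D_j)$, so $S_4(x)=D_0(x)\cup D_1(x)\cup\dots\cup D_4(x)$. The map $f$ is not $LC_2$-measurable at $x$ if there exist an open neighbourhood $U\subseteq Y$ of $f(x)$ and such a set $S_4(x)$ with $f^{-1}(U)\cap S_4(x)=D_0(x)\cup D_2(x)\cup D_4(x)$. *)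

(* Defs.v *)
From mathcomp Require Import all_boot all_order all_algebra.
From mathcomp Require Import all_classical all_reals all_analysis.
Set Implicit Arguments.
Unset Strict Implicit.
Unset Printing Implicit Defensive.
Import Order.TTheory GRing.Theory Num.Theory numFieldNormedType.Exports.
Local Open Scope classical_set_scope.
Local Open Scope ring_scope.

Definition LC1 (T : topologicalType) (A : set T) : Prop :=
  exists U C : set T, [/\ open U, closed C & A = U `&` C].

Definition LC2 (T : topologicalType) (A : set T) : Prop :=
  exists B C : set T, [/\ LC1 B, LC1 C & A = B `|` C].

Definition not_LC2_measurable (X Y : topologicalType) (f : X -> Y) : Prop :=
  exists U : set Y, open U /\ ~ LC2 (f @^-1` U).

(* For k = 0 the only index family is the empty one, with sum 0, so
   D R 0 = [set 0]. *)
Definition D (R : realType) (k : nat) : set R :=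
  [set t | exists n : 'I_k -> nat,
     [/\ forall i, (0 < n i)%N,
         forall i j : 'I_k, (i < j)%N -> (n i < n j)%N
       & t = \sum_(i < k) 2 ^- n i]].
Arguments D : clear implicits.

Definition S4 (R : realType) : set R :=
  D R 0 `|` D R 1 `|` D R 2 `|` D R 3 `|` D R 4.
Arguments S4 : clear implicits.

(* h restricts to a homeomorphism of the subspace A of T onto the subspace
   h @` A of U, with inverse g; the values of h outside A and of g outside
   h @` A are irrelevant. *)
Definition homeo_onto_image (T U : topologicalType) (A : set T) (h : T -> U)
    : Prop :=
  {within A, continuous h} /\
  exists g : U -> T,
    {within h @` A, continuous g} /\ (forall t, A t -> g (h t) = t).

(* The sets S4(x) and Dj(x) are h @` S4 R and h @` D R j. *)
Definition not_LC2_measurable_at (R : realType) (X Y : topologicalType)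
    (f : X -> Y) (x : X) : Prop :=
  exists U : set Y, open_nbhs (f x) U /\
  exists h : R -> X,
    [/\ homeo_onto_image (S4 R) h, h 0 = x
      & f @^-1` U `&` (h @` S4 R) =
        h @` D R 0 `|` h @` D R 2 `|` h @` D R 4].

(* Main.v *)
Require Import Defs.
From mathcomp Require Import all_boot all_order all_algebra.
From mathcomp Require Import all_classical all_reals all_analysis.
From mathcomp Require Import zify lra.

Set Implicit Arguments.
Unset Strict Implicit.
Unset Printing Implicit Defensive.
Import Order.TTheory GRing.Theory Num.Theory numFieldNormedType.Exports.
Import metricType_numDomainType.
Local Open Scope classical_set_scope.
Local Open Scope ring_scope.

(** The idea is to alternate between A and its complement.  Start from A, take
the points outside A that are limits of points of A, then the points of A that
are limits of those, and so on.  Four steps give [residue A 4], the points of A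
at which a tree of nested limits of depth 4 begins, with alternating colours
A / not A.  This set is empty exactly when A is LC2 ([LC2_residue]): the
successive closures cut A into two differences of closed sets, and conversely
a descent through nested limits, kept inside suitable open sets, never comes back
to an LC1 piece of A once it has left A.

So f is not LC2-measurable iff some f @^-1` U has a nonempty fourth residue, and
it remains to identify points of the residue with copies of S4.

The points of S4 are indexed by the sequences of at most four natural numbers:
the gaps of the increasing sequence of exponents ([bsum], [S4_bsum]).  Appending
a large gap moves the point only a little ([bsum_rcons]), so a continuous copy of
S4 with the prescribed colours puts h 0 in the fourth residue.

Conversely, from a point of the residue one chooses a tree of points of X indexed
by the same sequences ([residue_tree]), where the subtrees hanging at a node lie
in disjoint annuli shrinking to that node.  The map [bsum] has the same annular
property ([separated_bsum]).  In a tree with that property, being close to a node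
means being that node or descending from it through a child of large index; this
description is the same for all such trees, hence matching the nodes of two of
them is a homeomorphism ([separated_transfer]). *)

(** * Alternating residues and LC2 sets *)

Section Residues.
Variable T : topologicalType.
Implicit Types A : set T.

Fixpoint residue A (n : nat) : set T :=
  if n is m.+1 then closure (residue A m) `&` (if odd m then A else ~` A)
  else A.

Lemma residue_parity A n : residue A n `<=` (if odd n then ~` A else A).
Proof. by case: n => [|n] //= y [_]; case: (odd n). Qed.

(** Descend from a point of residue A 4 in B = U1 `&` C1.  The next point, chosen
in U1, is outside A, hence outside C1; from then on the descent stays off C1.
The point after that is again in A, so it lies in C = U2 `&` C2; the following one
leaves C2 in the same way.  The last point would be in A but in neither piece. *)
Lemma residue4_disjoint A B C :
  LC1 B -> LC1 C -> A = B `|` C -> residue A 4 `&` B = set0.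
Proof.
move=> [U1 [C1 [oU1 cC1 ->]]] [U2 [C2 [oU2 cC2 ->]]] AE.
rewrite -subset0 => x [[/= + Ax] [U1x C1x]].
move=> /(_ U1 (open_nbhs_nbhs (conj oU1 U1x))) [y [[/= cly nAy] U1y]].
have nC1y : (~` C1) y by move=> C1y; apply: nAy; rewrite AE; left.
have oC1 : open (~` C1) by exact: closed_openC.
have oC2 : open (~` C2) by exact: closed_openC.
move: cly => /(_ (U1 `&` ~` C1)) [].
  by apply: open_nbhs_nbhs; split=> //; exact: openI.
move=> z [[/= clz Az] [U1z nC1z]].
have [U2z C2z] : (U2 `&` C2) z by move: Az; rewrite AE => -[[]|].
move: clz => /(_ (U2 `&` ~` C1)) [].
  by apply: open_nbhs_nbhs; split=> //; exact: openI.
move=> w [[/= clw nAw] [U2w nC1w]].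
have nC2w : (~` C2) w by move=> C2w; apply: nAw; rewrite AE; right.
move: clw => /(_ (~` C1 `&` ~` C2)) [].
  by apply: open_nbhs_nbhs; split=> //; exact: openI.
by move=> v [+ [nC1v nC2v]]; rewrite AE => -[[]|[]].
Qed.

(** With F1, ..., F4 the closures of the residues 0, ..., 3, an empty fourth
residue gives A = (F1 minus F2) union (F3 minus F4). *)
Lemma LC2_residue A : LC2 A <-> residue A 4 = set0.
Proof.
split=> [[B [C [lB lC AE]]]|r4].
  rewrite -subset0 => x rx.
  have := @residue_parity A 4 x rx; rewrite /= {1}AE => -[Bx|Cx].
    by have := conj rx Bx; rewrite -[_ /\ _]/((_ `&` _) x) (residue4_disjoint lB lC).
  have := conj rx Cx; rewrite -[_ /\ _]/((_ `&` _) x) (residue4_disjoint lC lB)//.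
  by rewrite setUC.
exists (~` closure (residue A 1) `&` closure A).
exists (~` closure (residue A 3) `&` closure (residue A 2)).
split.
- exists (~` closure (residue A 1)), (closure A).
  by split=> //; [exact/closed_openC/closed_closure | exact: closed_closure].
- exists (~` closure (residue A 3)), (closure (residue A 2)).
  by split=> //; [exact/closed_openC/closed_closure | exact: closed_closure].
- rewrite predeqE => x; split=> [Ax|[[n1 c0]|[n3 c2]]].
  + have [c1|n1] := pselect (closure (residue A 1) x); last first.
      by left; split=> //; exact: subset_closure.
    right; split; last by apply: subset_closure; split.
    by move=> c3; have : residue A 4 x; [split|rewrite r4].
  + apply: contrapT => nAx; apply: n1; apply: subset_closure.
    by split.
  + apply: contrapT => nAx; apply: n3; apply: subset_closure.
    by split.
Qed.

End Residues.

(** * Trees whose branches lie in disjoint annuli *)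

Section SeparatedTrees.
Variable R : realType.

(** phi is a tree of depth k of points of M, nodes being finite sequences: the
subtree through the child g of a node lies in the closed annulus of radii a g and
b g around that node, these annuli are disjoint, and they shrink to the node. *)
Fixpoint separated (M : metricType R) (k : nat) (phi : seq nat -> M) : Prop :=
  if k is k'.+1 then
    (exists a b : nat -> R,
      [/\ forall g, 0 < a g,
          forall g, b g.+1 < a g,
          forall e, 0 < e -> exists g, b g < e
        & forall g u, (size u <= k')%N ->
            a g <= mdist (phi [::]) (phi (g :: u)) <= b g]) /\
    (forall g, separated k' (fun u => phi (g :: u)))
  else True.

Lemma annuli_disjoint (a b : nat -> R) :
  (forall g, b g.+1 < a g) -> (forall g, a g <= b g) ->
  forall g g', (g < g')%N -> b g' < a g.
Proof.
move=> ba ab g; elim=> [//|g' IH]; rewrite ltnS leq_eqVlt => /predU1P[->//|gg'].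
by rewrite (lt_trans (ba _))// (le_lt_trans (ab _))// IH.
Qed.

(** The distance to the root alone tells the subtrees apart: the annulus of index
g is at a positive distance from its two neighbours. *)
Lemma separated_isolated (M : metricType R) k (phi : seq nat -> M) g u :
  separated k phi -> (size (g :: u) <= k)%N ->
  exists2 d, 0 < d & forall s, (size s <= k)%N ->
    mdist (phi (g :: u)) (phi s) < d -> exists v, s = g :: v.
Proof.
case: k => [//|k] [[a [b [a0 ba _ abP]]] _] su.
have ab g' : a g' <= b g' by case/andP: (abP g' [::] isT); exact: le_trans.
have dis := annuli_disjoint ba ab.
pose d := Num.min (a g - b g.+1) (if g is g'.+1 then a g' - b g else 1).
exists d => [|s ss].
  rewrite /d lt_min subr_gt0 ba /=.
  by case: g {su d} => [|g]; rewrite ?subr_gt0.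
case: s ss => [_|g' v sv].
  rewrite metric_sym => lt_d; exfalso.
  have /andP[] := abP g u su.
  rewrite leNgt => /negP + _; apply; apply: lt_le_trans lt_d _.
  by rewrite /d ge_min gerBl (le_trans _ (ab _))// ltW.
have /andP[h1 h2] := abP g u su; have /andP[h3 h4] := abP g' v sv.
have [gg'|g'g|->] := ltngtP g g'; last by exists v.
- rewrite lt_min => /andP[lt_d _]; exfalso.
  have t := metric_triangle (phi [::]) (phi (g' :: v)) (phi (g :: u)).
  have : b g' <= b g.+1.
    move: gg'; rewrite leq_eqVlt => /predU1P[<-//|gg'].
    by rewrite ltW// (lt_le_trans (dis _ _ gg')).
  by move: t; rewrite [mdist (phi (g' :: v)) _]metric_sym; lra.
- rewrite lt_min => /andP[_ lt_d]; exfalso.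
  have t := metric_triangle (phi [::]) (phi (g :: u)) (phi (g' :: v)).
  case: g su @d lt_d h1 h2 t g'g => [//|g] su _ lt_d h1 h2 t; rewrite ltnS => g'g.
  have : a g <= a g'.
    move: g'g; rewrite leq_eqVlt => /predU1P[->//|g'g].
    by rewrite (le_trans (ab _))// ltW// dis.
  by lra.
Qed.

Lemma separated_inj (M : metricType R) k (phi : seq nat -> M) s s' :
  separated k phi -> (size s <= k)%N -> (size s' <= k)%N ->
  phi s = phi s' -> s = s'.
Proof.
elim: k phi s s' => [|k IH] phi [|g u] [|g' v] // sep ss ss' E.
- have [d d0 /(_ [::] isT)] := separated_isolated sep ss'.
  by rewrite E mdistxx => /(_ d0)[].
- have [d d0 /(_ [::] isT)] := separated_isolated sep ss.
  by rewrite E mdistxx => /(_ d0)[].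
- have [d d0 /(_ _ ss')] := separated_isolated sep ss.
  rewrite E mdistxx => /(_ d0)[w [gE _]]; congr cons => //.
  apply: (IH (fun u => phi (g :: u))) => //; last by rewrite E gE.
  exact: sep.2.
Qed.

(** At the root, a point of phi near the root has a large first index, and so its
counterpart in psi is near the root of psi.  Elsewhere, a point near a node is in
the same subtree by isolation, and the claim is inherited from that subtree. *)
Lemma separated_continuous (M N : metricType R) k
    (phi : seq nat -> M) (psi : seq nat -> N) s e :
  separated k phi -> separated k psi -> (size s <= k)%N -> 0 < e ->
  exists2 d, 0 < d & forall s', (size s' <= k)%N ->
    mdist (phi s) (phi s') < d -> mdist (psi s) (psi s') < e.
Proof.
elim: k phi psi s => [|k IH] phi psi s sphi spsi.
  by case: s => // _ e0; exists 1 => // -[|//] _ _; rewrite mdistxx.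
case: s => [_ e0|g u su e0].
  move: sphi spsi => [[a [b [a0 ba _ abP]]] _] [[a' [b' [_ ba' b'0 abP']]] _].
  have ab g' : a g' <= b g' by case/andP: (abP g' [::] isT); exact: le_trans.
  have ab' g' : a' g' <= b' g'.
    by case/andP: (abP' g' [::] isT); exact: le_trans.
  have [n b'n] := b'0 _ e0.
  exists (a n) => // -[|g u] su; first by rewrite !mdistxx.
  have /andP[h1 h2] := abP g u su; have /andP[h3 h4] := abP' g u su => lt_a.
  apply: le_lt_trans h4 _; have [gn|ng|->//] := ltngtP g n.
    by have := annuli_disjoint ba ab gn; have := ab n; lra.
  by have := annuli_disjoint ba' ab' ng; have := ab' n; lra.
have [d1 d10 iso] := separated_isolated sphi su.
have [d2 d20 cont] := IH _ _ u (sphi.2 g) (spsi.2 g) su e0.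
exists (Num.min d1 d2) => [|s' ss']; first by rewrite lt_min d10.
rewrite lt_min => /andP[/(iso _ ss')[v vE]]; rewrite vE in ss' *.
exact: cont.
Qed.

(** Applied in both directions, this gives a homeomorphism between the sets of
nodes of the two trees. *)
Lemma separated_transfer (M N : metricType R) k
    (phi : seq nat -> M) (psi : seq nat -> N) :
  separated k phi -> separated k psi ->
  exists h : M -> N, (forall s, (size s <= k)%N -> h (phi s) = psi s) /\
    {within phi @` [set s | (size s <= k)%N], continuous h}.
Proof.
move=> sphi spsi.
have /choice[h hP] : forall x, exists y, forall s,
    (size s <= k)%N -> phi s = x -> y = psi s.
  move=> x; have [[s ss sx]|nx] :=
    pselect ((phi @` [set s | (size s <= k)%N]) x).
    exists (psi s) => s' ss' s'x; congr psi.
    by apply: (separated_inj sphi); rewrite ?sx.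
  by exists (psi [::]) => s ss sx; case: nx; exists s.
have hE s : (size s <= k)%N -> h (phi s) = psi s by move=> ss; exact: hP.
exists h; split=> //; apply/subspace_continuousP => _ [s ss <-].
apply/cvgrPdist_lt => e e0.
have [d d0 dP] := separated_continuous sphi spsi ss e0.
apply/nbhs_mdistP; exists d => //= _ /[swap] -[s' ss' <-].
by rewrite /from_subspace !hE//; exact: dP.
Qed.

End SeparatedTrees.

(** * The sets D_k and S4 as trees of binary sums *)

Section BinarySums.
Variable R : realType.

(** The sum of 2 ^- n_i over the exponents n_1 < n_2 < ... whose successive gaps,
starting from 0, are the entries of s plus one.  Indexing by gaps makes every
sequence admissible and the tree self-similar. *)
Fixpoint bsum (s : seq nat) : R :=
  if s is g :: u then 2 ^- g.+1 * (1 + bsum u) else 0.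

Lemma exp2V_gt0 g : 0 < 2 ^- g :> R.
Proof. by rewrite invr_gt0 exprn_gt0. Qed.

Lemma exp2VS g : 2 ^- g.+1 = 2 ^- g / 2 :> R.
Proof. by rewrite exprSr invfM mulrC. Qed.

Lemma exp2V_le1 g : 2 ^- g <= 1 :> R.
Proof. by rewrite invf_le1 ?exprn_gt0// exprn_ege1// ler1n. Qed.

Lemma exp2V_small (r e : R) : 0 < r -> 0 < e -> exists g, r * 2 ^- g < e.
Proof.
move=> r0 e0; have er0 : 0 < e / r by rewrite divr_gt0.
have [n _ /(_ n (leqnn _))] := near_infty_natSinv_expn_lt (PosNum er0).
by rewrite /= mul1r ltr_pdivlMr// mulrC; exists n.
Qed.

(** The upper bound is strictly below 1 by a margin depending only on the depth;
this margin is what separates consecutive annuli. *)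
Lemma bsum_bounds k u : (size u <= k)%N -> 0 <= bsum u <= 1 - 2 ^- k.
Proof.
elim: u k => [|g u IH] k /=; first by rewrite lexx subr_ge0 exp2V_le1.
case: k => [//|k] /IH /andP[l r]; rewrite (exp2VS k).
have g0 := exp2V_gt0 g.+1; apply/andP; split.
  by rewrite mulr_ge0 ?addr_ge0// ltW.
have : 2 ^- g.+1 * (1 + bsum u) <= 2^-1 * (1 + bsum u).
  rewrite ler_wpM2r ?addr_ge0// exp2VS.
  by have := exp2V_le1 g; lra.
by lra.
Qed.

(** The subtrees of bsum are affine images of bsum, hence the affine form needed
for the induction. *)
Lemma separated_bsum_affine k (c r : R) : 0 < r ->
  separated k (fun s => c + r * bsum s : R^o).
Proof.
elim: k c r => [//|k IH] c r r0; split; last first.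
  move=> g; have := IH (c + r * 2 ^- g.+1) (r * 2 ^- g.+1).
  rewrite pmulr_rgt0// exp2V_gt0 => /(_ isT).
  congr separated; apply/funext => u /=.
  by rewrite -addrA mulrDr mulr1 mulrDr mulrA.
exists (fun g => r * 2 ^- g.+1), (fun g => r * 2 ^- g.+1 * (2 - 2 ^- k)).
have rg g : 0 < r * 2 ^- g by rewrite pmulr_rgt0// exp2V_gt0.
have k0 := exp2V_gt0 k; have k1 := exp2V_le1 k.
split => [//|g|e e0|g u su] /=.
- rewrite (exp2VS g.+1) mulrA; have := rg g.+1; set x := r * _ => x0.
  by have := mulr_gt0 x0 k0; lra.
- have [g gP] := exp2V_small r0 e0; exists g; rewrite exp2VS mulrA.
  by move: gP (rg g); set x := r * _ => gP x0; have := mulr_gt0 x0 k0; lra.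
- have /andP[l1 l2] := bsum_bounds su.
  rewrite /mdist /= mulr0 addr0 [c + _ - c]addrC addKr.
  rewrite mulrA; have := rg g.+1; set x := r * _ => x0.
  rewrite ger0_norm; last by rewrite mulr_ge0 ?addr_ge0// ltW.
  apply/andP; split; last by rewrite ler_pM2l//; lra.
  by rewrite ler_peMr ?lerDl// ltW.
Qed.

Lemma separated_bsum k : separated k (bsum : seq nat -> R^o).
Proof.
have := separated_bsum_affine k 0 (@ltr01 R).
by congr separated; apply/funext => s; rewrite add0r mul1r.
Qed.

Lemma bsum_rcons s g : `|bsum (rcons s g) - bsum s| <= 2 ^- g.+1.
Proof.
elim: s => [|g' s IH] /=.
  by rewrite addr0 mulr1 subr0 gtr0_norm// exp2V_gt0.
rewrite -mulrBr addrAC opprD addrA subrr add0r addrC normrM.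
rewrite (gtr0_norm (exp2V_gt0 _)) (le_trans _ IH)// ler_piMl//.
exact: exp2V_le1.
Qed.

Lemma D_bsum k : D R k = bsum @` [set s | size s = k].
Proof.
elim: k => [|k IH].
  rewrite predeqE => t; split=> [[n [_ _ ->]]|[[|//] _ <-]].
    by exists [::] => //; rewrite big_ord0.
  by exists (fun=> 0%N); split=> [[]|[]|] //; rewrite big_ord0.
rewrite predeqE => t; split=> [[n [n0 nS ->]]|[[//|g u] [su] <-]] /=.
  pose m i := (n (lift ord0 i) - n ord0)%N.
  have nlt i : (n ord0 < n (lift ord0 i))%N by apply: nS.
  have : D R k (\sum_(i < k) 2 ^- m i).
    exists m; split=> // [i|i j ij]; rewrite /m ?subn_gt0//.
    have := nS (lift ord0 i) (lift ord0 j); rewrite !lift0 ltnS => /(_ ij).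
    by have := nlt i; have := nlt j; lia.
  rewrite IH => -[u /= su uE].
  exists ((n ord0).-1 :: u) => /=; first by rewrite su.
  rewrite prednK// uE big_ord_recl mulrDr mulr1 mulr_sumr.
  congr (_ + _); apply: eq_bigr => i _.
  by rewrite -invfM -exprD /m subnKC// ltnW.
have : D R k (bsum u) by rewrite IH; exists u.
move=> [n [n0 nS ->]].
exists (fun i => if unlift ord0 i is Some j then g.+1 + n j else g.+1)%N.
split=> [i|i j|].
- by case: unliftP.
- case: (unliftP ord0 i) => [i' ->|->]; case: (unliftP ord0 j) => [j' ->|->] //.
    by rewrite !lift0 ltnS => /nS; lia.
  by move=> _; have := n0 j'; lia.
- rewrite big_ord_recl unlift_none mulrDr mulr1 mulr_sumr.
  congr (_ + _); apply: eq_bigr => i _.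
  by rewrite liftK exprD invfM.
Qed.

Lemma S4_bsum : S4 R = bsum @` [set s | (size s <= 4)%N].
Proof.
rewrite /S4 !D_bsum predeqE => t; split.
  by move=> [[[[]|]|]|] [s /= ss <-]; exists s => //=; rewrite ss.
move=> [s /= + <-]; case E : (size s) => [|[|[|[|[|//]]]]] _.
- by do 4 left; exists s.
- by do 3 left; right; exists s.
- by do 2 left; right; exists s.
- by left; right; exists s.
- by right; exists s.
Qed.

End BinarySums.

(** * Trees growing from a point of a residue *)

Section ResidueTrees.
Variables (R : realType) (X : metricType R).

Lemma shrinking_sequence (P : set X) p (d : R) : closure P p -> ~ P p -> 0 < d ->
  exists q : nat -> X, forall g, [/\ P (q g), 0 < mdist p (q g),
    mdist p (q g) < d * 2 ^- g.+1 & mdist p (q g.+1) < mdist p (q g) / 2].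
Proof.
move=> cP nP d0.
have /choice[pick pickP] : forall e : R, exists q, 0 < e ->
    [/\ P q, 0 < mdist p q & mdist p q < e].
  move=> e; have [e0|_] := ltP 0 e; last by exists p.
  have [q [Pq]] := cP _ (nbhsx_ballx p e e0); rewrite ballEmdist /= => pq.
  exists q => _; split=> //; rewrite mdist_gt0; apply/eqP => pE.
  by apply: nP; rewrite pE.
pose q := fix q g := pick (if g is g'.+1 then mdist p (q g') / 2 else d / 2).
have qP g : [/\ P (q g), 0 < mdist p (q g) & mdist p (q g) < d * 2 ^- g.+1].
  elim: g => [|g [_ q0 qlt]] /=.
    by rewrite expr1; apply: pickP; rewrite divr_gt0.
  have /pickP[h1 h2 h3] : 0 < mdist p (q g) / 2 by rewrite divr_gt0.
  by split=> //; rewrite (lt_trans h3)// exp2VS mulrA ltr_pM2r.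
exists q => g; have [h1 h2 h3] := qP g; split=> //.
by have /pickP[] : 0 < mdist p (q g) / 2 by rewrite divr_gt0.
Qed.

(** The children q g of p are taken in the previous residue, each at most half as
far from p as the one before.  The subtree at q g is grown within a quarter of
mdist p (q g), so it stays in the annulus of radii 3/4 and 5/4 of that distance;
these annuli are disjoint because 5/4 * 1/2 < 3/4.  The bound by d is what lets the
construction be repeated inside a prescribed annulus. *)
Lemma residue_tree (A : set X) k p (d : R) : 0 < d -> residue A k p ->
  exists psi : seq nat -> X, [/\ psi [::] = p,
    forall u, (size u <= k)%N -> residue A (k - size u) (psi u),
    forall u, (size u <= k)%N -> mdist p (psi u) < d
  & separated k psi].
Proof.
elim: k p d => [|k IH] p d d0 rp.
  by exists (fun=> p); split=> // -[|//] //; rewrite mdistxx.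
have np : ~ residue A k p.
  move=> /residue_parity; have := residue_parity rp => /=.
  by case: (odd k) => /=; move=> h1 h2; [exact: h2 | exact: h1].
have [q qP] := shrinking_sequence rp.1 np d0.
pose r g := mdist p (q g).
have /choice[Psi PsiP] : forall g, exists psi : seq nat -> X, [/\ psi [::] = q g,
    forall u, (size u <= k)%N -> residue A (k - size u) (psi u),
    forall u, (size u <= k)%N -> mdist (q g) (psi u) < r g / 4
  & separated k psi].
  by move=> g; have [h1 h2 _ _] := qP g; apply: IH => //; rewrite divr_gt0.
pose psi s := if s is g :: u then Psi g u else p.
have ann g u : (size u <= k)%N ->
    r g * (3 / 4) <= mdist p (psi (g :: u)) <= r g * (5 / 4).
  move=> su; have [_ _ /(_ u su) /= lt_r _] := PsiP g.
  have t1 := metric_triangle p (q g) (Psi g u).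
  have t2 := metric_triangle p (Psi g u) (q g).
  by move: t1 t2; rewrite [mdist (Psi g u) (q g)]metric_sym -/(r g); lra.
exists psi; split=> //.
- move=> [//|g u] su; rewrite subSS; have [_ + _ _] := PsiP g; exact.
- move=> [|g u] su; first by rewrite mdistxx.
  have /andP[_ h] := ann g u su; have [_ _ + _] := qP g; rewrite -/(r g) exp2VS.
  have := exp2V_le1 R g; rewrite -(ler_pM2l d0) mulrA.
  by set x := d * _; lra.
- split; last by move=> g; have [] := PsiP g.
  exists (fun g => r g * (3 / 4)), (fun g => r g * (5 / 4)).
  split=> [g|g|e e0|g u su].
  + by have [_ h _ _] := qP g; rewrite mulr_gt0.
  + by have [_ h _] := qP g; rewrite -/(r g) -/(r g.+1) in h * => ?; lra.
  + have [g gP] := exp2V_small d0 e0; exists g.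
    have [_ h0 h _] := qP g; rewrite -/(r g) exp2VS mulrA in h0 h.
    by move: h0 h gP; set x := d * _; lra.
  + exact: ann.
Qed.

End ResidueTrees.

Theorem mainTheorem7 (R : realType) (X Y : metricType R) (f : X -> Y) :
  not_LC2_measurable f <-> exists x : X, not_LC2_measurable_at R f x.
Proof.
split=> [[U [oU nLC]]|[x [U [[oU Ufx] [h [[hc [g [_ gh]]] h0 hE]]]]]].
  set A := f @^-1` U in nLC.
  have [x rx] : residue A 4 !=set0.
    by apply/set0P/eqP => r0; apply: nLC; apply/LC2_residue.
  exists x, U; split; first by split=> //; exact: (residue_parity rx).
  have [psi [psi0 psir _ spsi]] := residue_tree ltr01 rx.
  have sb := separated_bsum R 4.
  have [h [hE hc]] := separated_transfer sb spsi.
  have [g [gE gc]] := separated_transfer spsi sb.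
  have SE : h @` S4 R = psi @` [set s | (size s <= 4)%N].
    rewrite S4_bsum image_comp; apply: eq_imagel => s /= ss; exact: hE.
  have DE j : (j <= 4)%N -> h @` D R j = psi @` [set s | size s = j].
    move=> j4; rewrite D_bsum image_comp; apply: eq_imagel => s /= ss.
    by apply: hE; rewrite ss.
  exists h; split.
  - split; first by rewrite S4_bsum.
    exists g; split; first by rewrite SE.
    by move=> t; rewrite S4_bsum => -[s ss <-]; rewrite hE// gE.
  - by rewrite -psi0 -hE.
  - rewrite SE !DE// predeqE => y; split.
      move=> [Ay [s /= ss sy]]; have := residue_parity (psir s ss); rewrite sy.
      case E : (size s) ss => [|[|[|[|[|//]]]]] _ //=.
      + by move=> _; left; left; exists s.
      + by move=> _; left; right; exists s.
      + by move=> _; right; exists s.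
    move=> [[]|] [s /= ss <-]; (split; last by exists s => //=; rewrite ss);
      have := psir s; rewrite ss => /(_ isT); exact: residue_parity.
exists U; split=> //; set A := f @^-1` U in hE * => /LC2_residue r0.
have memS s : (size s <= 4)%N -> S4 R (bsum R s).
  by move=> ss; rewrite S4_bsum; exists s.
(* h and bsum are injective, so the level of a node decides its colour. *)
have colour s : (size s <= 4)%N -> A (h (bsum R s)) <-> ~~ odd (size s).
  move=> ss; split=> [As|ev].
    have : (A `&` h @` S4 R) (h (bsum R s)).
      by split=> //; exists (bsum R s) => //; exact: memS.
    rewrite hE !D_bsum.
    suff even j : (j <= 4)%N -> ~~ odd j ->
        (h @` (bsum R @` [set s | size s = j])) (h (bsum R s)) ->
        ~~ odd (size s).
      by move=> [[]|]; exact: even.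
    move=> j4 ev [_ [s' /= ss' <-] hh].
    have s'4 : (size s' <= 4)%N by rewrite ss'.
    have bE : bsum R s' = bsum R s.
      by rewrite -(gh _ (memS s ss)) -hh gh//; exact: memS.
    by rewrite -(separated_inj (separated_bsum R 4) s'4 ss bE) ss'.
  suff : (A `&` h @` S4 R) (h (bsum R s)) by case.
  rewrite hE !D_bsum.
  case E : (size s) ss ev => [|[|[|[|[|//]]]]] //= _ _.
  - by left; left; exists (bsum R s) => //; exists s.
  - by left; right; exists (bsum R s) => //; exists s.
  - by right; exists (bsum R s) => //; exists s.
(* A node at level 4 - j is a limit of its children, at level 4 - (j - 1). *)
suff res j s : (j + size s)%N = 4%N -> residue A j (h (bsum R s)).
  by have := res 4%N [::] erefl; rewrite r0.
elim: j s => [|j IH] s js; first by apply/colour; rewrite (js : size s = 4%N).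
have ss : (size s <= 4)%N by lia.
split; last first.
  have := colour s ss; have -> : odd (size s) = ~~ odd j by lia.
  by case: (odd j) => /= cs; [apply/cs | move=> /cs].
move=> B Bs; move/subspace_continuousP: hc => /(_ _ (memS s ss) B Bs).
rewrite /= => /nbhs_ballP [e /= e0 eB].
have [n nP] := exp2V_small ltr01 e0; rewrite mul1r in nP.
exists (h (bsum R (rcons s n))); split; first by apply: IH; rewrite size_rcons; lia.
apply: eB; last by apply: memS; rewrite size_rcons; lia.
rewrite /ball /= distrC (le_lt_trans (bsum_rcons _ _ _))//.
by rewrite (le_lt_trans _ nP)// exp2VS; have := exp2V_gt0 R n; lra.
Qed.
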